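(* Let $F$ be a finite field. Every nilpotent element in $Z(M_2(F))$ is of one of the following forms: (i) $aN$ or $aM$ for some $a\in F\setminus\{0\}$; (ii) $aN_k$ for some $a,k\in F\setminus\{0\}$.
   Context: $Z(M_2(F))$ denotes the set of nonzero zero-divisors of the ring $M_2(F)$ of $2\times 2$ matrices over $F$. Notation: $N=\begin{bmatrix}0&1\\0&0\end{bmatrix}$, $M=\begin{bmatrix}0&0\\1&0\end{bmatrix}$, $N_k=\begin{bmatrix}1&k\\-\frac1k&-1\end{bmatrix}$ for $k\in F\setminus\{0\}$. *)

(* Defs.v *)
From mathcomp Require Import all_boot all_order all_algebra.

Set Implicit Arguments.
Unset Strict Implicit.
Unset Printing Implicit Defensive.

Import GRing.Theory.
Local Open Scope ring_scope.

(* A zero-divisor may be one on either side, as the ring is not assumed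
   to be commutative. *)
Definition is_zero_divisor (R : finNzRingType) (x : R) : bool :=
  [exists y : R, (y != 0) && ((x * y == 0) || (y * x == 0))].

Definition nonzero_zero_divisors (R : finNzRingType) : {set R} :=
  [set x : R | (x != 0) && is_zero_divisor x].

Definition nilpotent_element (R : nzRingType) (x : R) : Prop :=
  exists2 n : nat, (0 < n)%N & x ^+ n = 0.

Definition mx2 (T : nmodType) (a b c d : T) : 'M[T]_2 :=
  \matrix_(i < 2, j < 2) (nth [::] [:: [:: a; b]; [:: c; d]] i)`_j.

Definition matN (F : fieldType) : 'M[F]_2 := mx2 0 1
                                                 0 0.

Definition matM (F : fieldType) : 'M[F]_2 := mx2 0 0
                                                 1 0.

Definition matNk (F : fieldType) (k : F) : 'M[F]_2 := mx2 1          k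
                                                          (- (1 / k)) (-1).

(* Main.v *)
Require Import Defs.
From mathcomp Require Import all_boot all_order all_algebra.
From mathcomp Require Import ring.

(** A nilpotent 2 x 2 matrix [A] over a field has determinant zero, since
    [\det] is multiplicative, so Cayley-Hamilton reads [A ^ 2 = (\tr A) A] and
    hence [A ^ (n + 1) = (\tr A) ^ n A]: a nonzero nilpotent [A] has trace zero
    as well.  The entries [a b; c d] of [A] therefore satisfy [d = - a] and
    [b c = - a ^ 2].  If [a = 0] then [b] or [c] vanishes, which gives a
    multiple of [N] or [M]; otherwise [b] and [c] are nonzero, and factoring
    out [a] leaves [N_k] with [k = b / a], because [- 1 / k = c / a]. *)

Set Implicit Arguments.
Unset Strict Implicit.
Unset Printing Implicit Defensive.

Import GRing.Theory.
Local Open Scope ring_scope.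

Lemma mx2_entries (T : nmodType) (A : 'M[T]_2) :
  A = mx2 (A 0 0) (A 0 1) (A 1 0) (A 1 1).
Proof.
apply/matrixP => i j; rewrite mxE.
by case: i => [[|[|//]] ?]; case: j => [[|[|//]] ?] /=; congr (A _ _); apply: val_inj.
Qed.

Lemma scale_mx2 (R : nzRingType) (t a b c d : R) :
  t *: mx2 a b c d = mx2 (t * a) (t * b) (t * c) (t * d).
Proof.
apply/matrixP => i j; rewrite !mxE.
by case: i => [[|[|//]] ?]; case: j => [[|[|//]] ?].
Qed.

Lemma mul_mx2 (R : nzRingType) (a b c d a' b' c' d' : R) :
  mx2 a b c d * mx2 a' b' c' d' =
  mx2 (a * a' + b * c') (a * b' + b * d') (c * a' + d * c') (c * b' + d * d').
Proof.
apply/matrixP => i j; rewrite !mxE !big_ord_recl big_ord0 addr0 !mxE.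
by case: i => [[|[|//]] ?]; case: j => [[|[|//]] ?].
Qed.

Lemma mxtrace_mx2 (R : nzRingType) (a b c d : R) : \tr (mx2 a b c d) = a + d.
Proof. by rewrite /mxtrace !big_ord_recl big_ord0 addr0 !mxE. Qed.

Lemma det_mx2 (R : comNzRingType) (a b c d : R) :
  \det (mx2 a b c d) = a * d - b * c.
Proof.
rewrite (expand_det_row _ 0) !big_ord_recl big_ord0 addr0 /cofactor !det_mx11.
by rewrite !mxE /= expr0 expr1 mul1r mulN1r mulrN.
Qed.

(** Cayley-Hamilton in size 2 with its constant term [\det A] gone, checked on
    the entries, which avoids extracting the coefficients of [char_poly A]. *)
Lemma sqr_mx2_det0 (R : comNzRingType) (A : 'M[R]_2) :
  \det A = 0 -> A * A = \tr A *: A.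
Proof.
rewrite (mx2_entries A) det_mx2 mxtrace_mx2 mul_mx2 scale_mx2.
move: (A 0 0) (A 0 1) (A 1 0) (A 1 1) => a b c d /eqP.
rewrite subr_eq0 => /eqP bcE.
by congr mx2; rewrite -1?[c * b]mulrC -?bcE; ring.
Qed.

Lemma exp_mx2_det0 (R : comNzRingType) (A : 'M[R]_2) n :
  \det A = 0 -> A ^+ n.+1 = \tr A ^+ n *: A.
Proof.
move=> detA; elim: n => [|n IHn]; first by rewrite expr1 expr0 scale1r.
by rewrite exprSr IHn -scalerAl sqr_mx2_det0 // scalerA -exprSr.
Qed.

Lemma det_expmx (R : comNzRingType) n (A : 'M[R]_n.+1) m :
  \det (A ^+ m) = \det A ^+ m.
Proof.
elim: m => [|m IHm]; first by rewrite !expr0 det1.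
by rewrite !exprS det_mulmx IHm.
Qed.

Lemma nilpotent_det0 (F : fieldType) n (A : 'M[F]_n.+1) :
  nilpotent_element A -> \det A = 0.
Proof.
case=> m m_gt0 Am0; apply/eqP.
have : \det (A ^+ m) == 0 by rewrite Am0 det0.
by rewrite det_expmx expf_eq0 m_gt0.
Qed.

(** If [A ^+ n.+1 = \tr A ^+ n *: A] vanishes, then either [\tr A] is nilpotent,
    hence zero in a field, or [A] itself is zero. *)
Lemma nilpotent_mx2_tr0 (F : fieldType) (A : 'M[F]_2) :
  nilpotent_element A -> \tr A = 0.
Proof.
move=> Anil; have detA := nilpotent_det0 Anil.
case: Anil => -[//|n] _; rewrite exp_mx2_det0 // => /eqP.
rewrite scaler_eq0 expf_eq0 => /orP[/andP[_ /eqP //]|/eqP ->].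
exact: mxtrace0.
Qed.

Theorem lemma2p2 (F : finFieldType) (A : 'M[F]_2)
    (AZ : A \in nonzero_zero_divisors 'M[F]_2) (Anil : nilpotent_element A) :
  (exists2 a : F, a != 0 & A = a *: matN F \/ A = a *: matM F) \/
  (exists a k : F, [/\ a != 0, k != 0 & A = a *: matNk k]).
Proof.
have A0 : A != 0 by move: AZ; rewrite inE => /andP[].
move: (nilpotent_det0 Anil) (nilpotent_mx2_tr0 Anil) A0.
rewrite (mx2_entries A) det_mx2 mxtrace_mx2 /matN /matM /matNk.
move: (A 0 0) (A 0 1) (A 1 0) (A 1 1) => a b c d detA /eqP.
rewrite addrC addr_eq0 => /eqP dE; rewrite {}dE in detA *.
have mx2_0 : mx2 0 0 0 0 = 0 :> 'M[F]_2.
  by rewrite -(scale0r (mx2 0 0 0 0)) scale_mx2 !mul0r.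
have bcE : b * c = - (a * a) by rewrite -[RHS]subr0 -{1}detA; ring.
have [a0|a_neq0] := eqVneq a 0.
  move/eqP: bcE; rewrite a0 mulr0 oppr0 mulf_eq0 => /orP[]/eqP-> A0; left.
  - exists c; last by right; rewrite scale_mx2 !mulr0 mulr1.
    by apply: contraNneq A0 => ->; rewrite mx2_0.
  - exists b; last by left; rewrite scale_mx2 !mulr0 mulr1.
    by apply: contraNneq A0 => ->; rewrite mx2_0.
have b_neq0 : b != 0.
  apply: contra_neq a_neq0 => b0; apply/eqP.
  by rewrite -sqrf_eq0 expr2 -oppr_eq0 -bcE b0 mul0r.
move=> _; right; exists a, (b / a); split=> //.
  by rewrite mulf_neq0 ?invr_eq0.
(* With [c] eliminated through [b * c = - a ^ 2], both sides are rational
   expressions in [a] and [b]. *)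
have -> : c = - (a * a) / b by rewrite -bcE mulrAC mulfV // mul1r.
by rewrite scale_mx2; congr mx2; field; rewrite ?a_neq0 ?b_neq0.
Qed.
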